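(* Let $k$ be a field, $S=k[x_1,\ldots,x_n]$, and $d\ge2$ an integer. Let $I=(\mathcal L(u,v))$, where $u=x_1^{a_1}\cdots x_n^{a_n}$ and $v=x_q^{b_q}\cdots x_n^{b_n}$ are monomials of degree $d$ with $q\ge2$ and $a_1,b_q>0$. Then $\mathrm{depth}(S/I)=0$ if and only if $x_nu/x_1\ge_{lex}v$.
   Context: Lexicographic order is taken with $x_1>\cdots>x_n$. $\mathcal L(u,v)$ is the set of all monomials $w$ of degree $d$ of $S$ with $u\ge_{lex}w\ge_{lex}v$, and $(\mathcal L(u,v))$ is the ideal of $S$ it generates. Depth is taken with respect to the graded maximal ideal $(x_1,\ldots,x_n)$. *)

(* Defs.v *)
From mathcomp Require Import all_boot all_order all_algebra.
From mathcomp Require Export mpoly.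

Set Implicit Arguments.
Unset Strict Implicit.
Unset Printing Implicit Defensive.

Import Order.Theory GRing.Theory.
Local Open Scope ring_scope.

Section Depth.
Variable R : comNzRingType.
Implicit Types (I m G : R -> Prop) (f g : R) (s : seq R).

Definition ideal_gen G : R -> Prop := fun f =>
  exists s : seq (R * R),
    (forall p, p \in s -> G p.2) /\ f = \sum_(p <- s) p.1 * p.2.

Definition ideal_adjoin I f : R -> Prop := ideal_gen (fun g => I g \/ g = f).

(* The class of f is a nonzerodivisor on R / I, written on representatives. *)
Definition regular_mod I f : Prop := forall g, I (f * g) -> I g.

(* f_1, ..., f_r is an (R / I)-regular sequence: f_j is a nonzerodivisor on
   R / (I + (f_1, ..., f_(j-1))) for each j, and R / (I + (f_1, ..., f_r)) is
   nonzero. *)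
Fixpoint regular_seq I s : Prop :=
  if s is f :: s' then regular_mod I f /\ regular_seq (ideal_adjoin I f) s'
  else ~ I 1.

Definition regular_seq_in m I s : Prop :=
  (forall f, f \in s -> m f) /\ regular_seq I s.

(* The depth of R / I with respect to m equals r: r is the greatest length of
   an (R / I)-regular sequence of elements of m. *)
Definition depth_quot_is m I (r : nat) : Prop :=
  (exists s, regular_seq_in m I s /\ size s = r) /\
  (forall s, regular_seq_in m I s -> (size s <= r)%N).

End Depth.

(* Pure lexicographic order on exponent vectors, variable 0 being the largest;
   the canonical order <= on 'X_{1..n} compares total degrees first. *)
Definition lex_le n (m1 m2 : 'X_{1..n}) : bool :=
  ((multinom_val m1 : n.-tuplelexi nat) <= multinom_val m2)%O.

Definition lexsegment n (d : nat) (u v w : 'X_{1..n}) : bool :=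
  [&& mdeg w == d, lex_le w u & lex_le v w].

Definition lexsegment_ideal (k : fieldType) n (d : nat) (u v : 'X_{1..n}) :
    {mpoly k[n]} -> Prop :=
  ideal_gen (fun f => exists2 w, lexsegment d u v w & f = 'X_[w]).

Definition irrelevant_ideal (k : fieldType) n : {mpoly k[n]} -> Prop :=
  ideal_gen (fun f => exists i : 'I_n, f = 'X_i).

(* Main.v *)
(* If x_n u / x_1 >= v, then w = u / x_1 lies outside I for degree reasons,
   while every x_i w lies between x_n w and x_1 w = u; so every element of the
   irrelevant ideal multiplies w into I, and none is regular.

   Otherwise a_1 = 1 and x_1 - x_n is regular on S / I.  This rests on the fact
   that a monomial w with x_1 w and x_n w in I lies in I: suppose not; then
   x_1 does not divide w, the generator dividing x_1 w is x_1 g with g | w,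
   and the generator dividing x_n w is x_n b with b | w.  If b <> w, replacing
   x_n by a variable of w / b gives a generator dividing w; if b = w, then
   g = b and v <= x_n g <= x_n u / x_1, a contradiction. *)
Require Import Defs.
From mathcomp Require Import all_boot all_order all_algebra.
From mathcomp Require Import zify.

Import Order.Theory GRing.Theory.
Local Open Scope ring_scope.

(** * Lexicographic order in a fixed degree *)

Section LexOrder.
Variable n : nat.
Implicit Types m : 'X_{1..n}.

(** The canonical order breaks ties of degree lexicographically. In a fixed degree this gives access
    to its compatibility with products of monomials. *)
Lemma lex_leE m1 m2 : mdeg m1 = mdeg m2 -> lex_le m1 m2 = (m1 <= m2)%O.
Proof.
move=> e; rewrite /lex_le.
by rewrite [RHS](_ : _ = mnmc_le m1 m2) // /mnmc_le lexi_cons e lexx.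
Qed.

Lemma mnm1_le (i j : 'I_n) : (i <= j)%N -> (U_(j)%MM <= U_(i)%MM :> 'X_{1..n})%O.
Proof.
rewrite leq_eqVlt => /predU1P [/val_inj -> // | ij].
apply/ltW/ltmcP; first by rewrite !mdeg1.
exists i => [l li|]; rewrite !mnm1E ?eqxx; last by rewrite -val_eqE /= gtn_eqF.
by rewrite -!val_eqE /= !gtn_eqF // (ltn_trans li).
Qed.

End LexOrder.

Lemma lex_le_ord0 n (m1 m2 : 'X_{1..n.+1}) :
  lex_le m1 m2 -> (m1 ord0 <= m2 ord0)%N.
Proof.
case: m1 => -[[|x1 s1] //= h1]; case: m2 => -[[|x2 s2] //= h2].
rewrite /lex_le !mnm_tnth !(tnth_nth 0%N) /=.
by rewrite [X in is_true X -> _](lexi_cons x1 s1 x2 s2) => /andP[].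
Qed.

Lemma lt_ord0_lex_le n (m1 m2 : 'X_{1..n.+1}) :
  (m1 ord0 < m2 ord0)%N -> lex_le m1 m2.
Proof.
case: m1 => -[[|x1 s1] //= h1]; case: m2 => -[[|x2 s2] //= h2].
rewrite /lex_le !mnm_tnth !(tnth_nth 0%N) /= => lt12.
rewrite [X in is_true X](lexi_cons x1 s1 x2 s2).
by rewrite !leEnat (ltnW lt12) leqNgt lt12.
Qed.

(** * Membership in monomial ideals *)

Section MonomialIdeal.

Lemma ideal_gen_sum (R : comNzRingType) (G : R -> Prop) (T : eqType)
    (r : seq T) (F : T -> R) :
  (forall x, x \in r -> ideal_gen G (F x)) -> ideal_gen G (\sum_(x <- r) F x).
Proof.
elim: r => [|x r IHr] Fr; first by exists [::]; split=> //; rewrite !big_nil.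
have [s [Gs Fx]] := Fr x (mem_head x r).
have [|t [Gt e]] := IHr; first by move=> y yr; apply: Fr; rewrite inE yr orbT.
exists (s ++ t); split; last by rewrite big_cons Fx e big_cat.
by move=> p; rewrite mem_cat => /orP[/Gs|/Gt].
Qed.

Variables (R : comNzRingType) (n : nat).

(** Multiplying by a generator shifts the support and sums create no new monomials; conversely, each
    term of [f] is a multiple of a generator dividing it. *)
Lemma monomial_idealP (P : 'X_{1..n} -> Prop) (f : {mpoly R[n]}) :
  ideal_gen (fun g => exists2 w, P w & g = 'X_[w]) f <->
  forall m, m \in msupp f -> exists2 w, P w & (w <= m)%MM.
Proof.
split=> [[s [Gs ->]] m|suppP].
  elim: s Gs => [|p s IHs] Gs; first by rewrite big_nil msupp0.
  rewrite big_cons => /msuppD_le; rewrite mem_cat => /orP[|]; last first.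
    by apply: IHs => r rs; apply: Gs; rewrite inE rs orbT.
  have [w Pw ->] := Gs p (mem_head p s).
  rewrite (perm_mem (msuppMX _ _)) => /mapP[m' _ ->].
  by exists w => //; apply: lem_addr.
rewrite [f]mpolyE; apply: ideal_gen_sum => m /suppP [w Pw lewm].
exists [:: (f@_m *: 'X_[m - w], 'X_[w])]; split.
  by move=> p; rewrite inE => /eqP ->; exists w.
by rewrite big_seq1 /= -scalerAl -mpolyXD submK.
Qed.

End MonomialIdeal.

Lemma mcoeff0M (R : comNzRingType) n (f g : {mpoly R[n]}) :
  (f * g)@_0 = f@_0 * g@_0.
Proof. exact: (rmorphM (mcoeff 0%MM)). Qed.

(** Used to see that 1 lies neither in I nor in I + (x_1 - x_n), and that elements of the irrelevant
    ideal have no constant term. *)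
Lemma ideal_gen_mcoeff0 (R : comNzRingType) n (G : {mpoly R[n]} -> Prop) f :
  (forall g, G g -> g@_0 = 0) -> ideal_gen G f -> f@_0 = 0.
Proof.
move=> G0 [s [Gs ->]]; rewrite raddf_sum big_seq big1 // => p /Gs /G0 p0.
by rewrite /= mcoeff0M p0 mulr0.
Qed.

(** Generators have degree [d], so the search can run over a finite type, which makes the predicate
    boolean. *)
Definition in_lexsegment {n} d (u v m : 'X_{1..n}) : bool :=
  [exists w : 'X_{1..n < d.+1}, lexsegment d u v w && (w <= m)%MM].

Lemma in_lexsegmentP {n d} {u v m : 'X_{1..n}} :
  reflect (exists2 w, lexsegment d u v w & (w <= m)%MM) (in_lexsegment d u v m).
Proof.
apply: (iffP existsP) => [[w /andP[]]|[w Lw lewm]]; first by exists w.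
have dw : (mdeg w < d.+1)%N by case/and3P: Lw => /eqP ->.
by exists (BMultinom dw); rewrite Lw.
Qed.

(** * Regularity of x_1 - x_n modulo I *)

Section LexsegmentColon.
Variables (n d : nat) (u v : 'X_{1..n.+1}).
Hypotheses (hu : mdeg u = d) (hv : mdeg v = d).
Hypotheses (hu1 : (0 < u ord0)%N) (hv1 : v ord0 = 0%N) (n_gt0 : (0 < n)%N).
Hypothesis hdepth : ~~ lex_le v (u - U_(ord0) + U_(ord_max))%MM.

Let inI := in_lexsegment d u v.

(** Generators have exponent at most 1 in x_1, since [u] does. One that divides x_1 w but not w has
    a larger exponent in x_1 than w, so these exponents are 1 and 0. *)
Lemma lexsegment_colon_ord0 {w : 'X_{1..n.+1}} :
  inI (w + U_(ord0))%MM -> ~~ inI w ->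
  w ord0 = 0%N /\
  exists2 m, lexsegment d u v (m + U_(ord0))%MM & (m <= w)%MM.
Proof.
move=> /in_lexsegmentP[g Lg /mnm_lepP legw] nIw.
have gu0 : (g ord0 <= u ord0)%N by case/and3P: Lg => _ /lex_le_ord0.
have u1 : (u ord0 <= 1)%N.
  (* If x_1^2 divided [u], then x_1 would still divide x_n u / x_1, which would exceed [v]. *)
  rewrite leqNgt; apply: contra hdepth => u_gt1; apply: lt_ord0_lex_le.
  by rewrite hv1 mnmDE mnmBE !mnm1E eqxx; lia.
have [gw0|] := leqP (g ord0) (w ord0).
  case: (negP nIw); apply/in_lexsegmentP; exists g => //; apply/mnm_lepP => i.
  have [->//|ni0] := eqVneq i ord0.
  by move: (legw i); rewrite mnmDE mnm1E eq_sym (negbTE ni0) addn0.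
move=> wg0; split; first by lia.
have g0 : (U_(ord0) <= g)%MM by rewrite lep1mP; lia.
exists (g - U_(ord0))%MM; first by rewrite submK.
apply/mnm_lepP => i; move: (legw i); rewrite mnmDE mnmBE; lia.
Qed.

Lemma lexsegment_colon (w : 'X_{1..n.+1}) :
  inI (w + U_(ord0))%MM -> inI (w + U_(ord_max))%MM -> inI w.
Proof.
move=> /lexsegment_colon_ord0 Iw0 /in_lexsegmentP[a La /mnm_lepP leaw].
apply: contraT => nIw.
have [w0 [g /and3P[/eqP dg leg _] legw]] := Iw0 nIw.
have /and3P[/eqP da _ leva] := La.
have [b def_a] : exists b, a = (b + U_(ord_max))%MM.
  (* If x_n did not divide [a], then [a] would already divide [w]. *)
  exists (a - U_(ord_max))%MM; rewrite submK // lep1mP; apply/eqP => a0.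
  case: (negP nIw); apply/in_lexsegmentP; exists a => //; apply/mnm_lepP => i.
  have [->|ni] := eqVneq i ord_max; first by rewrite a0.
  by move: (leaw i); rewrite mnmDE mnm1E eq_sym (negbTE ni) addn0.
subst a.
have lebw : (b <= w)%MM.
  by apply/mnm_lepP => i; move: (leaw i); rewrite !mnmDE leq_add2r.
have [/existsP [j bwj]|] := boolP [exists j, (b j < w j)%N].
  have lebjw : (b + U_(j) <= w)%MM.
    apply/mnm_lepP => i; move/mnm_lepP: lebw => /(_ i).
    by rewrite mnmDE mnm1E; case: eqVneq => [<-|_] /=; lia.
  case: (negP nIw); apply/in_lexsegmentP; exists (b + U_(j))%MM => //.
  have dj : mdeg (b + U_(j)) = d by rewrite -da !mdegD !mdeg1.
  apply/and3P; split; first exact/eqP.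
    (* The upper bound holds because x_1 divides [u] but not [w], hence not x_j b; the lower bound
       because x_j >= x_n. *)
    apply: lt_ord0_lex_le; apply: leq_ltn_trans hu1.
    by rewrite -w0 (mnm_lepP lebjw).
  move: leva; rewrite !lex_leE ?hv ?dj ?da // => /le_trans; apply.
  by rewrite lemc_add2r mnm1_le // -ltnS.
rewrite negb_exists => /forallP wb.
have {wb lebw leaw} def_b : b = w.
  by apply/mnmP => i; move/mnm_lepP: lebw => /(_ i); move: (wb i); lia.
subst b.
(* Both have degree d - 1, and [g] divides [w]. *)
have def_g : g = w.
  have : mdeg (w - g + g)%MM = mdeg g.
    by rewrite submK //; move: dg; rewrite -da !mdegD !mdeg1; lia.
  rewrite mdegD => /eqP; rewrite -[X in _ == X]add0n eqn_add2r mdeg_eq0.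
  by move=> /eqP wg0; rewrite -(submK legw) wg0 add0m.
subst g.
have u0 : (U_(ord0) <= u)%MM by rewrite lep1mP -lt0n.
have du' : mdeg (u - U_(ord0) + U_(ord_max)) = d.
  by rewrite -hu -[in RHS](submK u0) !mdegD !mdeg1.
case/negP: hdepth; move: leva leg; rewrite !lex_leE ?hv ?du' ?hu //.
move=> /le_trans leva leg; apply: leva; rewrite lemc_add2l.
by rewrite -(lemc_add2l _ _ U_(ord0)) submK.
Qed.

Lemma lexsegment_regular (k : fieldType) :
  regular_mod (@lexsegment_ideal k _ d u v) ('X_ord0 - 'X_ord_max).
Proof.
move=> g /monomial_idealP Ifg; apply/monomial_idealP => m mg.
apply/in_lexsegmentP.
have {}Ifg m' : ((g * 'X_ord0)@_m' != (g * 'X_ord_max)@_m' -> inI m').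
  move=> fg_neq0; apply/in_lexsegmentP/Ifg.
  by rewrite mcoeff_msupp mulrC mulrBr mcoeffB subr_eq0.
have gX m' i : (g * 'X_i)@_(m' + U_(i)) = g@_m' by rewrite addmC mcoeffMX.
(* Induction on the gap between the exponent of x_1 in [m] and [msize g], which bounds it on the
   support of [g]. *)
have [e] := ubnP (msize g - m ord0).
elim: e m mg => // e IHe m mg lt_e.
(* If the coefficient of x_1 m in (x_1 - x_n) g vanishes, then x_1 m / x_n is
   in the support of g, and its exponent of x_1 is larger. *)
have Im0 : inI (m + U_(ord0))%MM.
  have := Ifg (m + U_(ord0))%MM; rewrite gX.
  case: eqVneq => [gm _|_]; last exact.
  have : (m + U_(ord0))%MM \in msupp (g * 'X_ord_max).
    by rewrite mcoeff_msupp -gm -mcoeff_msupp.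
  rewrite (perm_mem (msuppMX _ _)) => /mapP[m' m'g def_m'].
  have m'0 : m' ord0 = (m ord0).+1.
    move/mnmP: (def_m') => /(_ ord0); rewrite !mnmDE !mnm1E eqxx.
    by rewrite -val_eqE /= gtn_eqF // addn1 add0n.
  have /in_lexsegmentP[w Lw lewm'] : inI m'.
    apply: IHe => //; rewrite m'0; move: (msize_mdeg_lt m'g) lt_e.
    have : (m' ord0 <= mdeg m')%N by rewrite mdegE (bigD1 ord0) //= leq_addr.
    by rewrite m'0; lia.
  apply/in_lexsegmentP; exists w => //; rewrite def_m'.
  exact/(lepm_trans lewm')/lem_addl.
(* As x_1 does not divide m, the coefficient of x_n m is that of m, up to
   sign. *)
apply: contraT => nIm.
have [m0 _] := lexsegment_colon_ord0 Im0 nIm.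
case/negP: nIm; apply: lexsegment_colon => //; apply: Ifg.
rewrite gX [X in X != _](_ : _ = 0); last first.
  apply/eqP; rewrite mcoeff_eq0 (perm_mem (msuppMX _ _)).
  apply/mapP => -[m' _ /mnmP /(_ ord0)]; rewrite !mnmDE !mnm1E eqxx m0.
  by rewrite -val_eqE /= gtn_eqF.
by rewrite eq_sym -mcoeff_msupp.
Qed.

End LexsegmentColon.

(** * The depth criterion *)

Theorem proposition2p3p2 (k : fieldType) (n d : nat) (hd : (2 <= d)%N)
  (u v : 'X_{1..n.+1}) (hu : mdeg u = d) (hv : mdeg v = d)
  (hu1 : (0 < u ord0)%N)
  (q : 'I_n.+1) (hq : (0 < q)%N)
  (hvq : (0 < v q)%N) (hv0 : forall i : 'I_n.+1, (i < q)%N -> v i = 0%N) :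
  depth_quot_is (@irrelevant_ideal k n.+1) (@lexsegment_ideal k n.+1 d u v) 0
  <-> lex_le v (u - U_(ord0) + U_(ord_max))%MM.
Proof.
have hv1 : v ord0 = 0%N by apply: hv0.
have n_gt0 : (0 < n)%N by rewrite -ltnS (leq_ltn_trans hq).
have I_mcoeff0 f : lexsegment_ideal d u v f -> f@_0 = 0 :> k.
  apply: ideal_gen_mcoeff0 => g [w /and3P[/eqP dw _ _] ->].
  by rewrite mcoeffX -mdeg_eq0 dw; case: eqP hd => // ->.
have m_mcoeff0 f : irrelevant_ideal f -> f@_0 = 0 :> k.
  by apply: ideal_gen_mcoeff0 => g [i ->]; rewrite mcoeffX mnm1_eq0.
split=> [[_ depth0]|hdepth].
  apply/negPn/negP => hdepth.
  suff: regular_seq_in (@irrelevant_ideal k n.+1) (lexsegment_ideal d u v)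
          [:: 'X_ord0 - 'X_ord_max] by move/depth0.
  have mX : irrelevant_ideal ('X_ord0 - 'X_ord_max : {mpoly k[n.+1]}).
    exists [:: (1, 'X_ord0); (-1, 'X_ord_max)]; split.
      by move=> p; rewrite !inE => /orP[] /eqP ->; [exists ord0|exists ord_max].
    by rewrite big_cons big_seq1 mul1r mulN1r.
  split=> [f|]; first by rewrite inE => /eqP ->.
  split; first exact: lexsegment_regular.
  move=> adj1; suff /eqP : (1 : {mpoly k[n.+1]})@_0 = 0.
    by rewrite mcoeff1 eqxx oner_eq0.
  apply: ideal_gen_mcoeff0 adj1 => g [/I_mcoeff0 //|->].
  exact: m_mcoeff0.
split.
  exists [::]; split=> //; split=> // /I_mcoeff0 /eqP.
  by rewrite mcoeff1 eqxx oner_eq0.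
move=> [//|f s] [mf [reg_f _]].
have {}mf : f@_0 = 0 by apply/m_mcoeff0/mf/mem_head.
have u0 : (U_(ord0) <= u)%MM by rewrite lep1mP -lt0n.
set w := (u - U_(ord0))%MM in hdepth.
have def_u : u = (w + U_(ord0))%MM by rewrite submK.
have dwi (i : 'I_n.+1) : mdeg (w + U_(i)) = d.
  by rewrite -hu def_u !mdegD !mdeg1.
have Iw (i : 'I_n.+1) : lexsegment d u v (w + U_(i)).
  apply/and3P; split; first exact/eqP.
    by rewrite {1}def_u lex_leE ?dwi // lemc_add2r mnm1_le.
  move: hdepth; rewrite !lex_leE ?dwi ?hv // => /le_trans; apply.
  by rewrite lemc_add2r mnm1_le // -ltnS.
have /monomial_idealP Xw : lexsegment_ideal d u v ('X_[w] : {mpoly k[n.+1]}).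
  (* As [f] has no constant term, every monomial of its product with ['X_[w]] is divisible by some
     x_i w. *)
  apply: reg_f; apply/monomial_idealP => m.
  rewrite (perm_mem (msuppMX _ _)) => /mapP[m' m'f ->].
  have [i m'i] : exists i, m' i != 0%N.
    apply/existsP; apply: contraLR m'f; rewrite negb_exists => /forallP m'0.
    rewrite (_ : m' = 0%MM) -?mcoeff_eq0 ?mf ?eqxx //.
    by apply/mnmP => i; rewrite mnm0E; apply/eqP/negPn.
  exists (w + U_(i))%MM => //; apply/mnm_lepP => j.
  by rewrite !mnmDE leq_add2l; apply/mnm_lepP: j; rewrite lep1mP.
have [|w' /and3P[/eqP dw' _ _] lew'] := Xw w; first by rewrite msuppX mem_head.
have := dwi ord0; rewrite mdegD mdeg1 -(submK lew') mdegD dw'; lia.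
Qed.
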